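(* Let $D=(V,E)$ be a transitive acyclic digraph, and let $\pi$ be an arrangement of $V(D)$ in which the vertices appear in non-increasing order of $d^+(v)-d^-(v)$. Then $\pi$ is a maximum arrangement of $D$.
   Context: $D$ is transitive if $(u,v),(v,w)\in E$ with $u\neq w$ implies $(u,w)\in E$, and acyclic if it has no directed cycle; $d^+(v),d^-(v)$ are out- and in-degree. An arrangement of an $n$-vertex digraph is a bijection $\pi:V\to\{1,\dots,n\}$, written $(v_1,\dots,v_n)$ when $\pi(v_i)=i$. For $1\le i\le n-1$, $c_i(\pi)$ is the number of edges with tail in $\{v_1,\dots,v_i\}$ and head in $\{v_{i+1},\dots,v_n\}$; the signature of $\pi$ is $(c_1,\dots,c_{n-1})$. An arrangement $\pi$ is maximum if $c_i(\pi)\ge c_i(\sigma)$ for every arrangement $\sigma$ of $D$ and every $i$. *)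

(* Defs.v *)
From mathcomp Require Import all_boot all_order all_algebra.

Set Implicit Arguments.
Unset Strict Implicit.
Unset Printing Implicit Defensive.

(* A finite digraph is a finType V with edge relation E : rel V; E u v means
   (u, v) is an edge with tail u and head v. *)

(* Weaker than [transitive E]: nothing is required when u = w, so that the
   condition is compatible with 2-cycles in a loopless digraph. *)
Definition transitive_digraph (V : finType) (E : rel V) : Prop :=
  forall u v w : V, E u v -> E v w -> u != w -> E u w.

(* Loops (length 1) and 2-cycles count as directed cycles, hence an acyclic
   digraph is in particular loopless. *)
Definition acyclic_digraph (V : finType) (E : rel V) : Prop :=
  forall p : seq V, ucycle E p -> p = [::].

Definition outdeg (V : finType) (E : rel V) (v : V) : nat :=
  #|[set w | E v w]|.

Definition indeg (V : finType) (E : rel V) (v : V) : nat :=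
  #|[set u | E u v]|.

Definition netdeg (V : finType) (E : rel V) (v : V) : int :=
  ((outdeg E v)%:Z - (indeg E v)%:Z)%R.

Definition arrangement (V : finType) (pi : V -> 'I_#|V|) : Prop :=
  bijective pi.

(* Ordinals start at 0, whereas arrangements take values in {1, ..., n}. *)
Definition position (V : finType) (pi : V -> 'I_#|V|) (v : V) : nat :=
  (pi v).+1.

Definition cut (V : finType) (E : rel V) (pi : V -> 'I_#|V|) (i : nat) : nat :=
  #|[set e : V * V |
      [&& E e.1 e.2, position pi e.1 <= i & i < position pi e.2]]|.

Definition maximum_arrangement (V : finType) (E : rel V)
    (pi : V -> 'I_#|V|) : Prop :=
  arrangement pi /\
  forall sigma : V -> 'I_#|V|, arrangement sigma ->
  forall i : nat, 1 <= i <= #|V| - 1 -> cut E sigma i <= cut E pi i.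

Definition netdeg_nonincreasing (V : finType) (E : rel V)
    (pi : V -> 'I_#|V|) : Prop :=
  forall u v : V, position pi u <= position pi v ->
  (netdeg E v <= netdeg E u)%R.

(* Main.v *)
Require Import Defs.
From mathcomp Require Import all_boot all_order all_algebra.
From mathcomp Require Import perm zify.

Set Implicit Arguments.
Unset Strict Implicit.
Unset Printing Implicit Defensive.

Import Order.TTheory GRing.Theory Num.Theory.

(** For a vertex set [A], the net degrees on [A] add up to the number of edges
    leaving [A] minus the number of edges entering [A].  If an edge [(u, v)]
    enters [A], then exchanging [u] and [v] strictly increases the number of
    edges leaving [A], by transitivity.  Hence a set of given size with the most
    outgoing edges has no incoming edge and its cut is its net degree sum.  This
    sum is largest on an initial segment of a non-increasing arrangement. *)

Definition cutset (V : finType) (E : rel V) (A : {set V}) : {set V * V} :=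
  [set e | [&& E e.1 e.2, e.1 \in A & e.2 \notin A]].

Lemma acyclic_asym (V : finType) (E : rel V) (u v : V) :
  acyclic_digraph E -> E u v -> ~~ E v u.
Proof.
move=> acE Euv; apply/negP=> Evu.
have [eq_uv|ne_uv] := eqVneq u v.
  have: [:: u] = [::] by apply: acE; rewrite /ucycle /= {2}eq_uv Euv.
  by [].
have: [:: u; v] = [::] by apply: acE; rewrite /ucycle /= inE Euv Evu ne_uv.
by [].
Qed.

(** By transitivity [u] inherits every out-neighbour of [v] and gains [v] itself, while [v] inherits
    every in-neighbour of [u]. *)
Lemma netdeg_edge_lt (V : finType) (E : rel V) (u v : V) :
  transitive_digraph E -> acyclic_digraph E -> E u v ->
  (netdeg E v < netdeg E u)%R.
Proof.
move=> trE acE Euv; rewrite /netdeg.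
have lt_out : outdeg E v < outdeg E u.
  apply/proper_card/properP; split.
    apply/subsetP=> w; rewrite !inE => Evw; apply: (trE _ _ _ Euv Evw).
    by apply: contraTneq Evw => <-; apply: acyclic_asym.
  exists v; rewrite inE // ; apply/negP=> Evv.
  by have := acyclic_asym acE Evv; rewrite Evv.
have le_in : indeg E u <= indeg E v.
  apply/subset_leq_card/subsetP=> w; rewrite !inE => Ewu; apply: (trE _ _ _ Ewu Euv).
  by apply: contraTneq Ewu => ->; apply: acyclic_asym.
lia.
Qed.

(** Applying [tperm u v] to both endpoints embeds the old cut in the new one: an edge [(v, b)]
    becomes [(u, b)] and an edge [(a, u)] becomes [(a, v)], both present by transitivity through
    [(u, v)]. *)
Lemma cutset_exchange (V : finType) (E : rel V) (B : {set V}) (u v : V) :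
  transitive_digraph E -> acyclic_digraph E ->
  E u v -> u \notin B -> v \in B ->
  #|cutset E B| < #|cutset E (tperm u v @^-1: B)|.
Proof.
move=> trE acE Euv uB vB; set t := tperm u v.
pose f (e : V * V) := (t e.1, t e.2).
have f_inj : injective f by move=> [a b] [c d] [/perm_inj -> /perm_inj ->].
rewrite -(card_imset _ f_inj); apply/proper_card/properP; split.
  apply/subsetP=> _ /imsetP[[a b] + ->].
  rewrite !inE /= !tpermK => /and3P[Eab aB bB]; rewrite aB bB !andbT.
  have ua : u != a by apply: contraNneq uB => ->.
  have vb : v != b by apply: contraNneq bB => <-.
  have [av|va] := eqVneq v a; have [bu|ub] := eqVneq u b.
  - by move: Eab; rewrite -av -bu (negPf (acyclic_asym acE Euv)).
  - by rewrite -av tpermR tpermD //; apply: (trE _ _ _ Euv _ ub); rewrite av.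
  - by rewrite -bu tpermL tpermD //; apply: (trE _ _ _ _ Euv); rewrite ?bu // eq_sym.
  - by rewrite !tpermD.
(* The edge [(u, v)] is new in the cut: it could only be the image of [(v, u)], which is not an
   edge. *)
exists (u, v); first by rewrite !inE /= tpermL tpermR Euv vB uB.
apply/imsetP=> -[[a b]]; rewrite !inE /= => /and3P[Eab _ _] [ua vb].
have av : a = v by rewrite -[a](tpermK u v) -/t -ua tpermL.
have bu : b = u by rewrite -[b](tpermK u v) -/t -vb tpermR.
by move: Eab; rewrite av bu (negPf (acyclic_asym acE Euv)).
Qed.

Lemma sum_outdeg (V : finType) (E : rel V) (A : {set V}) :
  \sum_(v in A) outdeg E v = #|[set e : V * V | E e.1 e.2 && (e.1 \in A)]|.
Proof.
rewrite -sum1dep_card (eq_bigl (fun e : V * V => (e.1 \in A) && E e.1 e.2)).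
  rewrite -(pair_big_dep (mem A) E (fun _ _ => 1)) /=.
  by apply: eq_bigr => v _; rewrite sum1dep_card.
by move=> e; rewrite andbC.
Qed.

Lemma sum_indeg (V : finType) (E : rel V) (A : {set V}) :
  \sum_(v in A) indeg E v = #|[set e : V * V | E e.1 e.2 && (e.2 \in A)]|.
Proof.
have swap_inj : injective (fun e : V * V => (e.2, e.1)).
  by move=> [a b] [c d] [-> ->].
(* In-degrees are out-degrees of the reversed digraph. *)
rewrite (sum_outdeg (fun x y => E y x)) -(card_preimset _ swap_inj).
by apply: eq_card => e; rewrite !inE.
Qed.

(** Edges with both endpoints in [A] are counted once by each degree sum and cancel;
    [cutset E (~: A)] collects the edges entering [A]. *)
Lemma sum_netdeg (V : finType) (E : rel V) (A : {set V}) :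
  (\sum_(v in A) netdeg E v = #|cutset E A|%:Z - #|cutset E (~: A)|%:Z)%R.
Proof.
rewrite /netdeg sumrB -!(big_morph Posz PoszD (erefl _)) sum_outdeg sum_indeg.
set O := [set _ | _]; set I := [set _ | _].
have -> : cutset E A = O :\: I.
  by apply/setP=> e; rewrite !inE; case: (E _ _) => //=; rewrite ?negbK andbC.
have -> : cutset E (~: A) = I :\: O.
  by apply/setP=> e; rewrite !inE; case: (E _ _) => //=; rewrite ?negbK andbC.
by rewrite -(cardsID I O) -(cardsID O I) (setIC I O) !PoszD opprD addrACA subrr add0r.
Qed.

(** Since the sizes agree, [f] may be replaced by [f - t]. The common part of [A] and [B] then
    cancels, leaving terms at most 0 on [B :\: A] and at least 0 on [A :\: B]. *)
Lemma sum_le_threshold (T : finType) (f : T -> int) (t : int) (A B : {set T}) :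
  #|A| = #|B| -> (forall x, x \in A -> (t <= f x)%R) ->
  (forall x, x \notin A -> (f x <= t)%R) ->
  (\sum_(x in B) f x <= \sum_(x in A) f x)%R.
Proof.
move=> eqAB geA leA.
have shift (C : {set T}) :
    (\sum_(x in C) f x = \sum_(x in C) (f x - t) + t *+ #|C|)%R.
  by rewrite sumrB sumr_const subrK.
rewrite !shift eqAB lerD2r (big_setID A) [leRHS](big_setID B) /= setIC.
rewrite lerD //.
apply: (@le_trans _ _ 0%R).
  by apply: sumr_le0 => x; rewrite inE subr_le0 => /andP[/leA].
by apply: sumr_ge0 => x; rewrite inE subr_ge0 => /andP[_ /geA].
Qed.

Lemma max_cutset_sum_netdeg (V : finType) (E : rel V) (B : {set V}) :
  transitive_digraph E -> acyclic_digraph E ->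
  exists2 C : {set V}, #|C| = #|B| &
    (#|cutset E B|%:Z <= \sum_(v in C) netdeg E v)%R.
Proof.
move=> trE acE.
(* The witness has the largest cut among all sets of the size of [B], so no exchange can improve
   it. *)
have [C /eqP cardC maxC] :=
  @arg_maxnP _ B (fun C => #|C| == #|B|) (fun C => #|cutset E C|) (eqxx _).
exists C => //; rewrite sum_netdeg.
suff -> : cutset E (~: C) = set0 by rewrite cards0 subr0 lez_nat; apply: maxC.
apply/setP=> -[u v]; rewrite !inE /= negbK; apply/and3P=> -[Euv uC vC].
have := cutset_exchange trE acE Euv uC vC; rewrite ltnNge (maxC (tperm u v @^-1: C) _ : _ <= _) //.
by rewrite card_preimset ?cardC //; apply: perm_inj.
Qed.

(** Positions start at 1 and ordinals at 0, so [position pi v <= i] unfolds to [pi v < i]. *)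
Lemma cut_cutset (V : finType) (E : rel V) (pi : V -> 'I_#|V|) (i : nat) :
  cut E pi i = #|cutset E [set v | pi v < i]|.
Proof. by apply: eq_card => e; rewrite !inE -leqNgt. Qed.

Theorem theorem5p1 (V : finType) (E : rel V) (pi : V -> 'I_#|V|)
    (E_transitive : transitive_digraph E)
    (E_acyclic : acyclic_digraph E)
    (pi_arrangement : arrangement pi)
    (pi_nonincreasing : netdeg_nonincreasing E pi) :
  maximum_arrangement E pi.
Proof.
split=> // sigma sigma_arr i /andP[i_gt0 le_i].
rewrite !cut_cutset; set B := [set v | sigma v < i]; set A := [set v | pi v < i].
have cardP (tau : V -> 'I_#|V|) :
    arrangement tau -> #|[set v | tau v < i]| = #|[set k : 'I_#|V| | k < i]|.
  move=> tau_bij; rewrite -(on_card_preimset (onW_bij _ tau_bij)).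
  by apply: eq_card => v; rewrite !inE.
have cardAB : #|A| = #|B| by rewrite !cardP.
have [C cardC leBC] := @max_cutset_sum_netdeg _ E B E_transitive E_acyclic.
(* An edge entering the initial segment would have its tail after its head, although its tail has
   the larger net degree. *)
have no_back : cutset E (~: A) = set0.
  apply/setP=> -[u v]; rewrite !inE /= negbK; apply/and3P=> -[Euv uA vA].
  have := netdeg_edge_lt E_transitive E_acyclic Euv.
  rewrite ltNge pi_nonincreasing // /position ltnS.
  by rewrite (leq_trans (ltnW vA)) // leqNgt.
have cutA := sum_netdeg E A; rewrite no_back cards0 subr0 in cutA.
rewrite -lez_nat -cutA; apply: le_trans leBC _.
have [g _ pigK] := pi_arrangement.
have lt_i : i.-1 < #|V|.
  by rewrite prednK // (leq_trans le_i) ?leq_subr.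
(* The last vertex of the segment [A], at 0-based index [i.-1]; its net degree is the threshold
   separating [A] from the rest. *)
pose w := g (Ordinal lt_i).
have pos_w : position pi w = i by rewrite /position /w pigK /= prednK.
apply: (@sum_le_threshold _ _ (netdeg E w)) => [|x|x]; first by rewrite cardC.
  by rewrite inE => xA; apply: pi_nonincreasing; rewrite pos_w.
rewrite inE -leqNgt => xA; apply: pi_nonincreasing; rewrite pos_w.
exact: leqW.
Qed.
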